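(* Let $\mathcal{A}$ be a $C^*$-algebra and $X$ a Stone space. A positive map $\phi\colon C(X)\to\mathcal{A}$ is $\sigma$-normal if and only if it is $\sigma$-additive on projections, i.e. for every sequence $(p_n)$ of pairwise orthogonal projections in $C(X)$ for which the infinite sum $\sum_n p_n$ exists in $C(X)$, one has $\phi(\sum_n p_n)=\sum_n\phi(p_n)$ (meaning the latter sum exists in $\mathcal{A}$ and equals the former).
   Context: All $C^*$-algebras are unital. A positive map $\phi\colon\mathcal{A}\to\mathcal{B}$ between $C^*$-algebras is $\sigma$-normal if $\phi(\sup_n a_n)=\sup_n\phi(a_n)$ for every norm-bounded monotone increasing sequence $(a_n)$ of self-adjoint elements whose supremum exists in $\mathcal{A}$ (supremum in the poset of self-adjoint elements). For a family $(a_i)_{i\in I}$ of positive elements in a $C^*$-algebra, its infinite sum $\sum_i a_i$ is the supremum (in the self-adjoint poset) of all finite partial sums, when it exists. This sum in $C(X)$ need not be the pointwise sum. *)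

(* Defs.v *)
From HB Require Import structures.
From mathcomp Require Import all_boot all_order all_algebra.
From mathcomp Require Import all_classical all_reals.
From mathcomp Require Import topology normedtype.
Import numFieldNormedType.Exports.
From mathcomp.real_closed Require Import complex.

Set Implicit Arguments.
Unset Strict Implicit.
Unset Printing Implicit Defensive.

Import Order.TTheory GRing.Theory Num.Theory.
Local Open Scope ring_scope.
Local Open Scope classical_set_scope.

Definition cabs (R : realType) (z : R[i]) : R := ComplexField.Normc.normc z.
Definition cconj (R : realType) (z : R[i]) : R[i] := conjc z.

Definition cstar_axioms (R : realType) (A : algType R[i])
    (star : A -> A) (nrm : A -> R) : Prop :=
  [/\
      [/\ (forall a, star (star a) = a),
          (forall a b, star (a + b) = star a + star b),
          (forall (c : R[i]) a, star (c *: a) = cconj c *: star a) &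
          (forall a b, star (a * b) = star b * star a)],
      [/\ (forall a, 0 <= nrm a), (forall a, nrm a = 0 -> a = 0),
          (forall a b, nrm (a + b) <= nrm a + nrm b),
          (forall (c : R[i]) a, nrm (c *: a) = cabs c * nrm a) &
          (forall a b, nrm (a * b) <= nrm a * nrm b)],
      (forall u : nat -> A,
         (forall e : R, 0 < e -> exists N, forall m n, (N <= m)%N -> (N <= n)%N ->
              nrm (u m - u n) < e) ->
         exists l, forall e : R, 0 < e -> exists N, forall n, (N <= n)%N ->
              nrm (u n - l) < e) &
      (forall a, nrm (star a * a) = nrm a ^+ 2)].

(** * Order notions in a *-ring, relative to a carrier predicate [P]
    (the whole type for an abstract C*-algebra; the continuous functions
    for C(X) realized inside X -> R[i]). *)
Section StarOrder.
Variables (T : Type) (add : T -> T -> T) (opp : T -> T) (mul : T -> T -> T)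
          (zero : T) (star : T -> T) (P : T -> Prop).

Definition selfadj (a : T) := star a = a.
Definition positive (a : T) := exists b, P b /\ a = mul (star b) b.
Definition sa_le (a b : T) := positive (add b (opp a)).
Definition is_sup (I : Type) (F : I -> T) (s : T) :=
  [/\ P s, selfadj s, (forall i, sa_le (F i) s) &
      (forall c, P c -> selfadj c -> (forall i, sa_le (F i) c) -> sa_le s c)].
(* finite partial sums over finite subsets of nat, given as duplicate-free lists *)
Definition fin_sum (a : nat -> T) (l : seq nat) := foldr (fun i acc => add (a i) acc) zero l.
Definition is_inf_sum (a : nat -> T) (s : T) :=
  is_sup (fun l : {l : seq nat | uniq l} => fin_sum a (proj1_sig l)) s.
Definition projection (p : T) := P p /\ mul p p = p /\ star p = p.
Definition monotone_sa (a : nat -> T) :=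
  (forall n, P (a n) /\ selfadj (a n)) /\ (forall n, sa_le (a n) (a n.+1)).
End StarOrder.

Section CX.
Variables (R : realType) (X : topologicalType).

Definition cont_fun (f : X -> R[i]) :=
  continuous (fun x => complex.Re (f x)) /\ continuous (fun x => complex.Im (f x)).

Definition fadd (f g : X -> R[i]) := fun x => f x + g x.
Definition fopp (f : X -> R[i]) := fun x => - f x.
Definition fmul (f g : X -> R[i]) := fun x => f x * g x.
Definition fzero : X -> R[i] := fun _ => 0.
Definition fstar (f : X -> R[i]) := fun x => cconj (f x).
Definition fscale (c : R[i]) (f : X -> R[i]) := fun x => c * f x.

Definition CX_positive := positive fmul fstar cont_fun.
Definition CX_le := sa_le fadd fopp fmul fstar cont_fun.
Definition CX_is_sup (I : Type) := @is_sup _ fadd fopp fmul fstar cont_fun I.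
Definition CX_is_inf_sum := is_inf_sum fadd fopp fmul fzero fstar cont_fun.
Definition CX_projection := projection fmul fstar cont_fun.
Definition CX_monotone := monotone_sa fadd fopp fmul fstar cont_fun.
Definition CX_bounded (a : nat -> X -> R[i]) := exists M : R, forall n x, cabs (a n x) <= M.
End CX.

Definition stone_space (X : topologicalType) :=
  [/\ compact [set: X], hausdorff_space X & totally_disconnected [set: X]].

Section Maps.
Variables (R : realType) (X : topologicalType) (A : algType R[i]) (star : A -> A)
          (nrm : A -> R).

Definition A_positive := positive (fun a b : A => a * b) star (fun _ => True).
Definition A_is_sup (I : Type) :=
  @is_sup A (fun a b => a + b) (fun a => - a) (fun a b => a * b) star (fun _ => True) I.
Definition A_is_inf_sum :=
  is_inf_sum (fun a b : A => a + b) (fun a => - a) (fun a b => a * b) 0 star (fun _ => True).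

Definition positive_map (phi : (X -> R[i]) -> A) :=
  [/\ (forall f g, cont_fun f -> cont_fun g -> phi (fadd f g) = phi f + phi g),
      (forall c f, cont_fun f -> phi (fscale c f) = c *: phi f) &
      (forall f, cont_fun f -> CX_positive f -> A_positive (phi f))].

Definition sigma_normal (phi : (X -> R[i]) -> A) :=
  forall (a : nat -> X -> R[i]) (s : X -> R[i]),
    CX_monotone a -> CX_bounded a -> CX_is_sup a s ->
    A_is_sup (fun n => phi (a n)) (phi s).

Definition sigma_additive_proj (phi : (X -> R[i]) -> A) :=
  forall (p : nat -> X -> R[i]) (s : X -> R[i]),
    (forall n, CX_projection (p n)) ->
    (forall n m, n <> m -> fmul (p n) (p m) = @fzero R X) ->
    CX_is_inf_sum p s ->
    A_is_inf_sum (fun n => phi (p n)) (phi s).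
End Maps.

(* Main.v *)
(* Normality implies additivity because the finite partial sums of orthogonal projections
   are cofinal with the sums of initial segments.

   Conversely, let [a n] increase to [u] in C(X) and put [f n = u - a n >= 0], bounded by
   [N]. Given [e > 0], separate [{f n <= e/2}] from the complement of [{f n < e}] by a
   clopen [W n]; as [u] is the supremum, the union of the [W n] is dense, so the
   indicators [q n] of the disjointified [W n] sum to [1] in C(X). With [S] a finite partial
   sum of the [q i] and [n] a bound for its indices, [f n <= N (1 - S) + e]. If [c]
   dominates every [phi (a n)], it follows that [phi 1 + (c - phi u + e phi 1) / N]
   dominates every [phi S], hence also [phi 1]; so [c - phi u + e phi 1 >= 0], and [e] is
   arbitrary.

   The order manipulations in A need that the elements [b^* b] form an archimedean closed
   cone. This is derived without spectral theory from the iterative square root of [1 - x]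
   for [|x| <= 1], the C*-identity applied to [s + i p], and Kaplansky's argument. *)

Require Import Defs.
From mathcomp Require Import all_boot all_order all_algebra.
From mathcomp Require Import all_classical all_reals.
From mathcomp Require Import topology normedtype sequences realfun.
Import numFieldNormedType.Exports.
From mathcomp.real_closed Require Import complex.
From mathcomp Require Import ring lra.

Set Implicit Arguments.
Unset Strict Implicit.
Unset Printing Implicit Defensive.

Import Order.TTheory GRing.Theory Num.Theory.
Local Open Scope ring_scope.
Local Open Scope complex_scope.

(** * Positive elements of a C*-algebra *)

Section CstarAlgebra.
Variables (R : realType) (A : algType R[i]) (star : A -> A) (nrm : A -> R).
Hypothesis HA : cstar_axioms star nrm.
Implicit Types (a b x y z : A) (e t : R).

Lemma starK a : star (star a) = a. Proof. by case: HA => -[]. Qed.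
Lemma starD a b : star (a + b) = star a + star b. Proof. by case: HA => -[]. Qed.
Lemma starM a b : star (a * b) = star b * star a. Proof. by case: HA => -[]. Qed.
Lemma starZ (c : R[i]) a : star (c *: a) = conjc c *: star a.
Proof. by case: HA => -[]. Qed.
Lemma starZr t a : star (t%:C *: a) = t%:C *: star a.
Proof. by rewrite starZ conjc_real. Qed.
Lemma starN a : star (- a) = - star a.
Proof. by rewrite -[in LHS]scaleN1r starZ rmorphN1 scaleN1r. Qed.
Lemma starB a b : star (a - b) = star a - star b.
Proof. by rewrite starD starN. Qed.
Lemma star0 : star 0 = 0.
Proof. by rewrite -[in LHS](subrr 0) starB subrr. Qed.
Lemma star1 : star 1 = 1.
Proof. by rewrite -[RHS]starK -[in RHS](mul1r (star 1)) starM starK mul1r. Qed.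
Lemma star_scalar t : star t%:C%:A = t%:C%:A.
Proof. by rewrite starZr star1. Qed.

Lemma nrm_ge0 a : 0 <= nrm a. Proof. by case: HA => _ []. Qed.
Lemma nrm_eq0 a : nrm a = 0 -> a = 0. Proof. by case: HA => _ [_ + *]; apply. Qed.
Lemma nrmD a b : nrm (a + b) <= nrm a + nrm b. Proof. by case: HA => _ []. Qed.
Lemma nrmM a b : nrm (a * b) <= nrm a * nrm b. Proof. by case: HA => _ []. Qed.
Lemma nrmZ (c : R[i]) a : nrm (c *: a) = cabs c * nrm a.
Proof. by case: HA => _ []. Qed.
Lemma nrm_cstar a : nrm (star a * a) = nrm a ^+ 2. Proof. by case: HA. Qed.
Lemma cabs_real t : cabs t%:C = `|t|.
Proof. by rewrite /cabs /= expr0n /= addr0 sqrtr_sqr. Qed.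
Lemma nrmZr t a : nrm (t%:C *: a) = `|t| * nrm a.
Proof. by rewrite nrmZ cabs_real. Qed.
Lemma nrm0 : nrm 0 = 0.
Proof. by rewrite -[in LHS](scale0r (0 : A)) (nrmZr 0) normr0 mul0r. Qed.
Lemma nrmN a : nrm (- a) = nrm a.
Proof. by rewrite -scaleN1r -(rmorphN1 (real_complex R)) nrmZr normrN1 mul1r. Qed.
Lemma nrmB a b : nrm (a - b) <= nrm a + nrm b.
Proof. by rewrite -(nrmN b) nrmD. Qed.
Lemma nrm_distC a b : nrm (a - b) = nrm (b - a).
Proof. by rewrite -nrmN opprB. Qed.
Lemma nrm1_le : nrm 1 <= 1.
Proof.
have := nrm_cstar 1; rewrite star1 mulr1 => h; have := nrm_ge0 1; nra.
Qed.
Lemma nrm_scalar t : 0 <= t -> nrm t%:C%:A <= t.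
Proof.
by move=> t0; rewrite nrmZr ger0_norm// -[leRHS]mulr1 ler_wpM2l// nrm1_le.
Qed.
(** The C*-identity gives [nrm a ^+ 2 <= nrm (star a) * nrm a], and one factor cancels. *)
Lemma nrm_star_le a : nrm a <= nrm (star a).
Proof.
have [->|a0] := eqVneq (nrm a) 0; first exact: nrm_ge0.
have agt0 : 0 < nrm a by rewrite lt_neqAle eq_sym a0 nrm_ge0.
by rewrite -(ler_pM2r agt0) -expr2 -nrm_cstar nrmM.
Qed.
Lemma nrm_star a : nrm (star a) = nrm a.
Proof. by apply/le_anti; rewrite nrm_star_le -[in leRHS](starK a) nrm_star_le. Qed.
Lemma nrm_sqr a : star a = a -> nrm (a * a) = nrm a ^+ 2.
Proof. by move=> ha; rewrite -nrm_cstar ha. Qed.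

(** Serves to pass identities to the limit of [sqrt_seq]: the defect is bounded by a fixed multiple
    of the approximation error. *)
Lemma eq0_small a e0 : 0 <= e0 -> (forall e, 0 < e -> nrm a <= e0 * e) -> a = 0.
Proof.
move=> e0_ge0 small; apply: nrm_eq0; apply/le_anti; rewrite nrm_ge0 andbT.
apply/ler_addgt0Pr => e e_gt0; rewrite add0r.
have e1 : 0 < e0 + 1 by lra.
apply: (le_trans (small (e / (e0 + 1)) _)); first exact: divr_gt0.
by rewrite mulrCA ler_piMr ?(ltW e_gt0)// ler_pdivrMr//; lra.
Qed.

(* [sqrt_seq x] converges to [1 - sqrt (1 - x)]; the scalar sequence, its value at [x = 1],
   dominates its increments when [nrm x <= 1]. *)
Fixpoint sqrt_scal n : R := if n is n'.+1 then 2^-1 * (1 + sqrt_scal n' ^+ 2) else 0.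
Fixpoint sqrt_seq x n : A :=
  if n is n'.+1 then (2^-1)%:C *: (x + sqrt_seq x n' * sqrt_seq x n') else 0.

Lemma sqrt_scal_bounds n :
  0 <= sqrt_scal n <= 1 /\ sqrt_scal n <= sqrt_scal n.+1.
Proof.
have h m : 0 <= sqrt_scal m <= 1.
  by elim: m => [|m /andP[t0 t1]] /=; [rewrite lexx ler01|apply/andP; nra].
by split => //=; have /andP[t0 t1] := h n; nra.
Qed.

Lemma sqrt_scal_cauchy e : 0 < e ->
  exists N, forall n, (N <= n)%N -> sqrt_scal n - sqrt_scal N < e.
Proof.
move=> e0; have hs : has_sup (range sqrt_scal).
  split; first by exists (sqrt_scal 0), 0%N.
  by exists 1 => _ [n _ <-]; have [/andP[]] := sqrt_scal_bounds n.
have [_ [N _ <-] hN] := sup_adherent e0 hs.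
exists N => n Nn; have : sqrt_scal n <= sup (range sqrt_scal).
  by apply: ub_le_sup; [case: hs|exists n].
by lra.
Qed.

(** * Convergence of the square root iteration *)

Section SqrtSeq.
Variable x : A.
Hypotheses (sx : star x = x) (x1 : nrm x <= 1).

Lemma nrm_half a : nrm ((2^-1)%:C *: a) = 2^-1 * nrm a.
Proof. by rewrite nrmZr ger0_norm// invr_ge0. Qed.

Lemma sqrt_seq_nrm n : nrm (sqrt_seq x n) <= sqrt_scal n.
Proof.
elim: n => [|n ih] /=; first by rewrite nrm0.
rewrite nrm_half ler_wpM2l ?invr_ge0//.
rewrite (le_trans (nrmD _ _))// lerD// (le_trans (nrmM _ _))// expr2.
by rewrite ler_pM ?nrm_ge0.
Qed.

Lemma subr_sqr_nc a b : a * a - b * b = a * (a - b) + (a - b) * b.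
Proof. by rewrite mulrBr mulrBl addrA subrK. Qed.

(** The increment of [y * y] factors through that of [y], so each step of the scalar recursion
    majorizes the corresponding step in the algebra. *)
Lemma sqrt_seq_step n :
  nrm (sqrt_seq x n.+1 - sqrt_seq x n) <= sqrt_scal n.+1 - sqrt_scal n.
Proof.
elim: n => [|n ih].
  by rewrite [sqrt_seq x 0]/= [sqrt_scal 0]/= !subr0 sqrt_seq_nrm.
set y1 := sqrt_seq x n.+1 in ih *; set y0 := sqrt_seq x n in ih *.
set t1 := sqrt_scal n.+1 in ih *; set t0 := sqrt_scal n in ih *.
have -> : sqrt_seq x n.+2 - y1 = (2^-1)%:C *: (y1 * (y1 - y0) + (y1 - y0) * y0).
  have -> : sqrt_seq x n.+2 = (2^-1)%:C *: (x + y1 * y1) by [].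
  have {2}-> : y1 = (2^-1)%:C *: (x + y0 * y0) by [].
  by rewrite -subr_sqr_nc -scalerBr opprD addrACA subrr add0r.
have -> : sqrt_scal n.+2 = 2^-1 * (1 + t1 ^+ 2) by [].
have t1E : t1 = 2^-1 * (1 + t0 ^+ 2) by [].
have [/andP[t00 _] _] := sqrt_scal_bounds n.
have [/andP[t10 _] _] := sqrt_scal_bounds n.+1.
have h1 : nrm (y1 * (y1 - y0)) <= t1 * (t1 - t0).
  by rewrite (le_trans (nrmM _ _))// ler_pM ?nrm_ge0// sqrt_seq_nrm.
have h0 : nrm ((y1 - y0) * y0) <= (t1 - t0) * t0.
  by rewrite (le_trans (nrmM _ _))// ler_pM ?nrm_ge0// sqrt_seq_nrm.
by rewrite nrm_half; have := nrmD (y1 * (y1 - y0)) ((y1 - y0) * y0); nra.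
Qed.

Lemma sqrt_seq_dist m n : (m <= n)%N ->
  nrm (sqrt_seq x n - sqrt_seq x m) <= sqrt_scal n - sqrt_scal m.
Proof.
elim: n => [|n ih]; first by rewrite leqn0 => /eqP->; rewrite !subrr nrm0.
rewrite leq_eqVlt => /orP[/eqP->|]; first by rewrite !subrr nrm0.
rewrite ltnS => /ih h; have s := sqrt_seq_step n.
rewrite -(subrK (sqrt_seq x n) (sqrt_seq x n.+1)) -addrA.
by rewrite (le_trans (nrmD _ _))//; lra.
Qed.

Lemma sqrt_seq_star n : star (sqrt_seq x n) = sqrt_seq x n.
Proof. by elim: n => [|n ih] /=; rewrite ?star0// starZr starD starM ih sx. Qed.

Lemma sqrt_seq_comm n z : x * z = z * x -> sqrt_seq x n * z = z * sqrt_seq x n.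
Proof.
move=> xz; elim: n => [|n ih] /=; first by rewrite mul0r mulr0.
by rewrite -scalerAl -scalerAr mulrDl mulrDr xz -mulrA ih !mulrA ih.
Qed.

Lemma sqrt_seq_cvg : exists y, forall e, 0 < e ->
  exists N, forall n, (N <= n)%N -> nrm (sqrt_seq x n - y) < e.
Proof.
have [_ _ complete _] := HA; apply: complete => e e0.
have [|N hN] := @sqrt_scal_cauchy (e / 2); first lra.
exists N => m n Nm Nn; have := hN _ Nm; have := hN _ Nn.
have := sqrt_seq_dist Nm; have := sqrt_seq_dist Nn.
set y := sqrt_seq x N; rewrite (nrm_distC _ y) => h1 h2 h3 h4.
rewrite -(subrK y (sqrt_seq x m)) -addrA.
by rewrite (le_lt_trans (nrmD _ _))//; lra.
Qed.

Lemma sqrt_one_sub : exists y, [/\ star y = y, nrm y <= 1,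
  (forall z, x * z = z * x -> y * z = z * y) & (1 - y) * (1 - y) = 1 - x].
Proof.
have [y hy] := sqrt_seq_cvg.
(* Two consecutive indices are provided because the fixed-point equation compares an iterate with
   its successor. *)
have near e : 0 < e -> exists n, nrm (sqrt_seq x n - y) < e /\
    nrm (sqrt_seq x n.+1 - y) < e.
  by move=> /hy[N hN]; exists N; rewrite !hN.
have y1 : nrm y <= 1.
  apply/ler_addgt0Pr => e /near[n [hn _]].
  have [/andP[_ tn1] _] := sqrt_scal_bounds n.
  have := sqrt_seq_nrm n; have := nrmB (sqrt_seq x n) (sqrt_seq x n - y).
  by rewrite subKr; lra.
exists y; split => //.
- apply/eqP; rewrite -subr_eq0; apply/eqP; apply: (@eq0_small _ 2) => // e.
  move=> /near[n [hn _]].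
  set d := sqrt_seq x n - y in hn *.
  have -> : star y - y = d - star d.
    by rewrite starB sqrt_seq_star opprB [RHS]addrC subrKA.
  by rewrite (le_trans (nrmB _ _))// nrm_star; lra.
- move=> z xz; apply/eqP; rewrite -subr_eq0; apply/eqP.
  apply: (@eq0_small _ (2 * nrm z)) => [|e /near[n [hn _]]].
    by rewrite mulr_ge0 ?nrm_ge0.
  set d := sqrt_seq x n - y in hn *.
  have -> : y * z - z * y = z * d - d * z.
    by rewrite /d mulrBr mulrBl (sqrt_seq_comm n xz) opprB [RHS]addrC subrKA.
  have z0 := nrm_ge0 z.
  have h1 : nrm (z * d) <= nrm z * e by rewrite (le_trans (nrmM _ _))// ler_wpM2l// ltW.
  have h2 : nrm (d * z) <= e * nrm z by rewrite (le_trans (nrmM _ _))// ler_wpM2r// ltW.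
  by rewrite (le_trans (nrmB _ _))//; lra.
(* The limit is a fixed point of the iteration, and [2 y = x + y^2] rearranges to
   [(1 - y)^2 = 1 - x]. *)
- have fix_y : y = (2^-1)%:C *: (x + y * y).
    apply/eqP; rewrite -subr_eq0; apply/eqP.
    apply: (@eq0_small _ 2) => // e /near[n [hn hn1]].
    set u := sqrt_seq x n in hn *.
    have -> : y - (2^-1)%:C *: (x + y * y) =
        (y - sqrt_seq x n.+1) + (2^-1)%:C *: (u * (u - y) + (u - y) * y).
      have -> : sqrt_seq x n.+1 = (2^-1)%:C *: (x + u * u) by [].
      have -> : u * (u - y) + (u - y) * y = (x + u * u) - (x + y * y).
        by rewrite -subr_sqr_nc opprD addrACA subrr add0r.
      by rewrite scalerBr subrKA.
    rewrite (le_trans (nrmD _ _))// nrm_half nrm_distC.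
    have [/andP[_ t1] _] := sqrt_scal_bounds n.
    have u1 : nrm u <= 1 by rewrite (le_trans (sqrt_seq_nrm n)).
    have h1 : nrm (u * (u - y)) <= 1 * e.
      by rewrite (le_trans (nrmM _ _))// ler_pM ?nrm_ge0// ltW.
    have h2 : nrm ((u - y) * y) <= e * 1.
      by rewrite (le_trans (nrmM _ _))// ler_pM ?nrm_ge0// ltW.
    have := nrmD (u * (u - y)) ((u - y) * y); lra.
  have y2 : y + y = x + y * y.
    rewrite {1 2}fix_y -scalerDl -rmorphD.
    by rewrite (_ : 2^-1 + 2^-1 = 1 :> R) ?scale1r//; lra.
  have -> : x = y + y - y * y by rewrite y2 addrK.
  by rewrite mulrBl mul1r mulrBr mulr1 -[in RHS]addrA [in RHS]opprD addrA.
Qed.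

End SqrtSeq.

(** * The cone of positive elements *)

Lemma scalar_comm t a : t%:C%:A * a = a * t%:C%:A.
Proof. by rewrite -scalerAl -scalerAr mul1r mulr1. Qed.

(* Avoids the spectrum: for self-adjoint [a] this says that [a] lies in a ball of radius [t]
   around [t]. It is shown to coincide with being of the form [b^* b]. *)
Definition spos a := star a = a /\ exists2 t, 0 < t & nrm (t%:C%:A - a) <= t.

(** With radius [t], the element [x = 1 - a / t] has norm at most 1; the root of [1 - x = a / t] is
    then rescaled by [sqrt t]. It commutes with everything that commutes with [a]. *)
Lemma spos_sqrt a : spos a -> exists s,
  [/\ spos s, s * s = a & forall z, a * z = z * a -> s * z = z * s].
Proof.
case=> sa [t t0 ta]; have tN0 : t != 0 by rewrite gt_eqF.
pose x := t^-1%:C *: (t%:C%:A - a).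
have sx : star x = x by rewrite starZr starB star_scalar sa.
have x1 : nrm x <= 1.
  by rewrite nrmZr gtr0_norm ?invr_gt0// mulrC ler_pdivrMr// mul1r.
have [y [sy y1 cy yy]] := sqrt_one_sub sx x1.
pose r := Num.sqrt t; have r0 : 0 < r by rewrite sqrtr_gt0.
have rr : r * r = t by rewrite -expr2 sqr_sqrtr// ltW.
exists (r%:C *: (1 - y)); split.
- split; first by rewrite starZr starB star1 sy.
  exists r => //; rewrite -scalerBr subKr nrmZr gtr0_norm//.
  by rewrite -[leRHS]mulr1 ler_pM2l.
- rewrite -scalerAl -scalerAr scalerA yy -rmorphM rr.
  by rewrite scalerBr scalerA -rmorphM mulfV// scale1r subKr.
- move=> z az; rewrite -scalerAl -scalerAr; congr (_ *: _).
  rewrite mulrBl mulrBr mul1r mulr1 cy// /x.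
  by rewrite -scalerAl -scalerAr mulrBl mulrBr az scalar_comm.
Qed.

Lemma mulii : 'i * 'i = -1 :> R[i].
Proof. by rewrite -expr2 sqr_i. Qed.

Lemma conjc_i : conjc 'i = - 'i :> R[i].
Proof. by apply/eqP; rewrite eq_complex /= oppr0 !eqxx. Qed.

(* [s + i p] has norm at most [sqrt t] by the C*-identity, and [s] is its real part. *)
Lemma circle_bound s p t : star s = s -> star p = p -> s * p = p * s -> 0 <= t ->
  s * s + p * p = t%:C%:A -> nrm (s * s) <= t.
Proof.
move=> ss sp cps t0 spt; pose u := s + 'i *: p.
have su : star u = s - 'i *: p.
  by rewrite starD starZ ss sp conjc_i scaleNr.
have uu : star u * u = t%:C%:A.
  rewrite su mulrDr !mulrBl -!scalerAl -!scalerAr scalerA cps -spt.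
  by rewrite subrKA mulii scaleN1r opprK.
have u2 : nrm u ^+ 2 <= t by rewrite -nrm_cstar uu nrm_scalar.
have su2 : nrm s <= nrm u.
  have -> : s = (2^-1)%:C *: (u + star u).
    rewrite su /u addrACA subrr addr0 scalerDr -scalerDl -rmorphD.
    by rewrite (_ : 2^-1 + 2^-1 = 1 :> R) ?scale1r//; lra.
  by rewrite nrm_half; have := nrmD u (star u); rewrite nrm_star; lra.
by rewrite nrm_sqr//; have := nrm_ge0 s; nra.
Qed.

(** Frees the radius in [spos]: any positive [t >= nrm a] works. Write [a = s^2] and [t - a = p^2]
    with commuting roots and apply the circle bound to [p]. *)
Lemma spos_nrm_bound a t : spos a -> 0 < t -> nrm a <= t -> nrm (t%:C%:A - a) <= t.
Proof.
move=> /spos_sqrt[s [[ss _] <- _]] t0 st.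
have /spos_sqrt[p [[sp _] pp cp]] : spos (t%:C%:A - s * s).
  by split; [rewrite starB star_scalar starM ss|exists t; rewrite ?subKr].
rewrite -pp; apply: (@circle_bound p s) => //; last 2 first.
- exact: ltW.
- by rewrite pp subrK.
- by apply: cp; rewrite mulrBl mulrBr scalar_comm mulrA.
Qed.

Lemma spos_sqr s : star s = s -> spos (s * s).
Proof.
move=> ss; have n0 := nrm_ge0 (s * s).
(* Adding 1 keeps the radius positive even when [s = 0]. *)
pose t := nrm (s * s) + 1; have t0 : 0 < t by rewrite /t; lra.
have /spos_sqrt[p [[sp _] pp cp]] : spos (t%:C%:A - s * s).
  split; first by rewrite starB star_scalar starM ss.
  by exists t => //; rewrite subKr /t; lra.
split; first by rewrite starM ss.
exists t => //; rewrite -pp; apply: (@circle_bound p s) => //; last 2 first.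
- exact: ltW.
- by rewrite pp subrK.
- by apply: cp; rewrite mulrBl mulrBr scalar_comm mulrA.
Qed.

Lemma spos_add a b : spos a -> spos b -> spos (a + b).
Proof.
move=> [sa [t t0 ta]] [sb [u u0 ub]]; split; first by rewrite starD sa sb.
exists (t + u); first exact: addr_gt0.
rewrite rmorphD scalerDl opprD addrACA.
by rewrite (le_trans (nrmD _ _))// lerD.
Qed.

Lemma spos_scale t a : 0 < t -> spos a -> spos (t%:C *: a).
Proof.
move=> t0 [sa [u u0 ua]]; split; first by rewrite starZr sa.
exists (t * u); first exact: mulr_gt0.
by rewrite rmorphM -scalerA -scalerBr nrmZr gtr0_norm// ler_pM2l.
Qed.

Lemma spos_nrm_sub a t : star a = a -> nrm a <= t -> 0 < t -> spos (t%:C%:A - a).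
Proof.
move=> sa ta t0; split; first by rewrite starB star_scalar sa.
by exists t => //; rewrite subKr.
Qed.

(** For [t > nrm b], the element [t - a = (t - b) + (b - a)] is positive. The commuting roots of [a]
    and [t - a] lie on a circle, whence [nrm a <= t]. *)
Lemma spos_le_nrm a b : spos a -> spos (b - a) -> nrm a <= nrm b.
Proof.
move=> pa pba; apply/ler_addgt0Pr => e e0; set t := nrm b + e.
have b0 := nrm_ge0 b; have t0 : 0 < t by rewrite /t; lra.
have [sa _] := pa; have sb : star b = b.
  by have [+ _] := pba; rewrite starB sa => /addIr.
have : spos (t%:C%:A - a).
  rewrite -(subrKA b); apply: spos_add => //.
  by apply: spos_nrm_sub => //; rewrite /t; lra.
move=> /spos_sqrt[p [[sp _] pp cp]].
have [s [[ss _] sse cs]] := spos_sqrt pa.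
rewrite -sse; apply: (@circle_bound s p) => //; last 2 first.
- exact: ltW.
- by rewrite pp sse addrC subrK.
apply/esym/cp; rewrite -sse mulrBl mulrBr scalar_comm.
by rewrite mulrA.
Qed.

(** A single radius [t] serves all [a + d b] with [0 < d <= 1], so the ball condition survives as
    [d] tends to 0. *)
Lemma spos_archimedean a b : star a = a ->
  (forall e, 0 < e -> spos (a + e%:C *: b)) -> spos a.
Proof.
move=> sa pab; split => //.
have a0 := nrm_ge0 a; have b0 := nrm_ge0 b.
pose t := nrm a + nrm b + 1; have t0 : 0 < t by rewrite /t; lra.
exists t => //; apply/ler_addgt0Pr => e e0.
(* Small enough that [d b] has norm at most [e]; the added 1 avoids a zero denominator. *)
pose d := Num.min 1 (e / (nrm b + 1)).
have d0 : 0 < d by rewrite lt_min ltr01/= divr_gt0//; lra.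
have d1 : d <= 1 by rewrite ge_min lexx.
have de : d * (nrm b + 1) <= e by rewrite -ler_pdivlMr ?ge_min ?lexx ?orbT//; lra.
have ndb : nrm (d%:C *: b) = d * nrm b by rewrite nrmZr gtr0_norm.
have h : nrm (a + d%:C *: b) <= t.
  by rewrite (le_trans (nrmD _ _))// ndb /t; nra.
have := spos_nrm_bound (pab _ d0) t0 h.
have -> : t%:C%:A - a = t%:C%:A - (a + d%:C *: b) + d%:C *: b.
  by rewrite opprD addrA subrK.
by have := nrmD (t%:C%:A - (a + d%:C *: b)) (d%:C *: b); rewrite ndb; nra.
Qed.

(** Replaces the comparison of the spectra of [x x^*] and [x^* x]. With [t = |x|^2] and [v = t + w],
    one has [(t - y) x = x v], hence [|v w v| = |x v|^2 <= t^3]. But [v w v = 2 t w^2 + t^2 w + w^3]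
    dominates [2 t w^2], of norm [2 t^3]; so [t = 0]. *)
Lemma spos_conj_neg_eq0 x : spos (x * star x) -> spos (- (star x * x)) -> x = 0.
Proof.
set y := x * star x; set w := - (star x * x) => py pw.
have [sw _] := pw; pose t := nrm x ^+ 2.
have yt : nrm y = t by rewrite /y -{1}(starK x) nrm_cstar nrm_star.
have wt : nrm w = t by rewrite nrmN nrm_cstar.
have [t0|t_neq0] := eqVneq t 0.
  by apply: nrm_eq0; apply/eqP; rewrite -sqrf_eq0 -/t t0.
have t0 : 0 < t by rewrite lt_neqAle eq_sym t_neq0 sqr_ge0.
pose T : A := t%:C%:A; pose v := T + w.
have yx : (t%:C%:A - y) * x = x * v.
  by rewrite mulrBl mulrDr scalar_comm mulrN mulrA.
have vb : nrm (v * w * v) <= t ^+ 3.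
  have -> : v * w * v = - (star (x * v) * (x * v)).
    by rewrite starM starD star_scalar sw mulrN mulNr !mulrA.
  rewrite nrmN nrm_cstar -yx.
  have h : nrm ((t%:C%:A - y) * x) <= t * nrm x.
    rewrite (le_trans (nrmM _ _))// ler_wpM2r ?nrm_ge0//.
    by rewrite spos_nrm_bound ?yt.
  have -> : t ^+ 3 = (t * nrm x) ^+ 2 by rewrite exprMn -/t -exprSr.
  by rewrite ler_sqr// nnegrE ?mulr_ge0 ?nrm_ge0 ?ltW.
have vw : v * w * v = (t + t)%:C *: (w * w) + ((t ^+ 2)%:C *: w + w * w * w).
  have TZ a : T * a = t%:C *: a by rewrite -scalerAl mul1r.
  have ZT a : a * T = t%:C *: a by rewrite -scalerAr mulr1.
  rewrite /v !(mulrDl, mulrDr) !ZT !TZ scalerA -rmorphM -expr2 -scalerAl.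
  rewrite rmorphD scalerDl.
  by rewrite addrAC addrA [LHS]addrC -!addrA; congr (_ + _); rewrite addrCA.
have [r [[sr _] rr cr]] := spos_sqrt pw.
have crw : r * w = w * r by exact: cr.
(* The cube is the square of the self-adjoint element [w r], where [r] is the root of [w]. *)
have pw3 : spos (w * w * w).
  have -> : w * w * w = (w * r) * (w * r).
    by rewrite -!mulrA; congr (w * _); rewrite mulrA crw -mulrA rr.
  by apply: spos_sqr; rewrite starM sr sw crw.
have : nrm ((t + t)%:C *: (w * w)) <= nrm (v * w * v).
  apply: spos_le_nrm.
    by apply: spos_scale; [exact: addr_gt0|exact: spos_sqr].
  rewrite vw addrC addKr; apply: spos_add => //.
  by apply: spos_scale => //; rewrite exprn_gt0.
rewrite nrmZr gtr0_norm ?addr_gt0// nrm_sqr// wt => h.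
have t3 : 0 < t ^+ 3 by rewrite exprn_gt0.
by exfalso; move: h; rewrite mulrDl -exprS; lra.
Qed.

(* Kaplansky's argument: for [h = b^* b], [m = |h|] and [v = m - h] (twice the negative
   part of [h]), [x = b v] satisfies [x^* x = - v m v]. *)
Lemma spos_cstar b : spos (star b * b).
Proof.
set h := star b * b; have sh : star h = h by rewrite starM starK.
have [m [pm mm cm]] := spos_sqrt (spos_sqr sh); have [sm _] := pm.
have cmh : m * h = h * m by apply: cm; rewrite mulrA.
have [r [[sr _] rr cr]] := spos_sqrt pm.
pose v := m - h; have sv : star v = v by rewrite starB sm sh.
have cmv : m * v = v * m by rewrite mulrBl mulrBr cmh.
have hv : h * v = - (m * v) by rewrite !mulrBr opprB mm cmh.
have vv : v * v = m * v + m * v by rewrite [in LHS]/v mulrBl hv opprK.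
have xx : star (b * v) * (b * v) = - (v * m * v).
  by rewrite starM sv -mulrA (mulrA (star b)) -/h hv mulrN mulrA.
have pvmv : spos (v * m * v).
  have -> : v * m * v = (r * v) * (r * v).
    by rewrite -rr mulrA -(cr v cmv) -!mulrA (cr v cmv).
  by apply: spos_sqr; rewrite starM sr sv (cr v cmv).
have bv0 : b * v = 0.
  set x := b * v in xx *; apply: spos_conj_neg_eq0; last by rewrite xx opprK.
  (* Up to scaling these are the real and imaginary parts of [x]. Since
     [x x^* + x^* x = (p^2 + q^2) / 2], the negativity of [x^* x] makes [x x^*] positive. *)
  pose p := x + star x; pose q := 'i *: (x - star x).
  have sp : star p = p by rewrite starD starK addrC.
  have sq : star q = q.
    by rewrite starZ conjc_i starB starK scaleNr -scalerN opprB.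
  have -> : x * star x =
      (2^-1)%:C *: (p * p + q * q) + v * m * v.
    have -> : q * q = - ((x - star x) * (x - star x)).
      by rewrite -scalerAl -scalerAr scalerA mulii scaleN1r.
    have -> : p * p - (x - star x) * (x - star x) =
        (x * star x + star x * x) + (x * star x + star x * x).
      rewrite {2}/p mulrDr mulrBr opprB [X in _ + X]addrC addrACA -mulrBl -mulrDl.
      rewrite opprB [p + (star x - x)]addrC addrA subrK.
      rewrite [p + (x - star x)]addrACA subrr addr0.
      by rewrite !mulrDl addrC addrACA.
    rewrite xx scalerDr -scalerDl -rmorphD (_ : 2^-1 + 2^-1 = 1 :> R); last lra.
    by rewrite scale1r subrK.
  by apply: spos_add => //; apply: spos_scale; rewrite ?invr_gt0//;
     apply: spos_add; exact: spos_sqr.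
have vmv0 : v * m * v = 0 by rewrite -[LHS]opprK -xx bv0 mulr0 oppr0.
(* From [v^2 = 2 m v] it follows that [v^3 = 2 v m v = 0]; the C*-identity applied twice to
   [v^4 = 0] then gives [v = 0], so [h = m]. *)
have v4 : (v * v) * (v * v) = 0.
  have v3 : v * (v * v) = 0 by rewrite vv mulrDr mulrA vmv0 addr0.
  by rewrite -mulrA v3 mulr0.
have v0 : v = 0.
  have sv2 : star (v * v) = v * v by rewrite starM sv.
  have := nrm_sqr sv2; rewrite v4 nrm0 (nrm_sqr sv) => /eqP.
  by rewrite eq_sym !sqrf_eq0 => /eqP /nrm_eq0.
by move/eqP: v0; rewrite subr_eq0 => /eqP <-.
Qed.

Lemma A_positiveP a : A_positive star a <-> spos a.
Proof.
split=> [[b [_ ->]]|/spos_sqrt[s [[ss _] <- _]]]; first exact: spos_cstar.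
by exists s; rewrite ss.
Qed.

End CstarAlgebra.

(** * Clopen sets of Stone spaces *)

Section StoneSpace.
Local Open Scope classical_set_scope.
Variable X : topologicalType.
Implicit Types (U V W Z : set X) (G : set (set X)).

(** If every member of [G] met [Z], the traces would generate a proper filter, and its cluster point
    in [Z] would lie in every closed member of [G]. *)
Lemma compact_directed_closed Z G : compact Z -> G setT -> setI_closed G ->
  (forall C, G C -> closed C) -> (forall z, Z z -> exists2 C, G C & ~ C z) ->
  exists2 C, G C & C `<=` ~` Z.
Proof.
move=> cZ GT GI Gcl Zout; apply: contrapT => meets.
pose F := filter_from G (fun C => C `&` Z).
have FF : Filter F.
  apply: filter_from_filter; first by exists setT.
  move=> C D GC GD; exists (C `&` D); first exact: GI.
  by move=> x [[Cx Dx] Zx].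
have PF : ProperFilter F.
  apply: filter_from_proper => C GC; apply: contrapT => CZ0; apply: meets.
  by exists C => // x Cx Zx; apply: CZ0; exists x.
have FZ : F Z by exists setT => // x [].
have [z [Zz clz]] := cZ F PF FZ.
have [C GC] := Zout z Zz; apply; apply: (Gcl C GC) => V Vz.
have [|x [[Cx _] Vx]] := clz (C `&` Z) V _ Vz; first by exists C.
by exists x.
Qed.

Hypothesis HX : stone_space X.

(** In a compact Hausdorff space the intersection [K] of the clopen sets containing [x] is
    connected; total disconnectedness then reduces it to [x]. *)
Lemma stone_zero_dimensional : zero_dimensional X.
Proof.
case: HX => cX hX dX x y xy; apply: contrapT => nsep.
pose G := [set C : set X | clopen C /\ C x].
have GT : G setT by split => //; exact: clopenT.
have GI : setI_closed G by move=> C D [cC Cx] [cD Dx]; split=> //; exact: clopenI.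
pose K := \bigcap_(C in G) C.
have clK : closed K by apply: closed_bigI => C [[]].
have Kx : K x by move=> C [].
suff conK : connected K.
  have Ky : K y.
    by move=> C [cC Cx]; apply: contrapT => nCy; apply: nsep; exists C.
  have := connected_component_max Kx (@subsetT _ K) conK Ky.
  by rewrite dX// => yx; move: xy; rewrite yx eqxx.
(* A nonempty relatively clopen part [B] of [K] has to be all of [K]. Normality provides a
   neighbourhood [V] of [B] with closure inside [C]. *)
move=> B [b Bb] [C oC BKC] [D cD BKD].
have clB : closed B by rewrite BKD; exact: closedI.
have BC : B `<=` C by rewrite BKC => z [].
have [V BV VC] : filter_from (set_nbhs B) closure C.
  by apply: (compact_normal hX cX clB); apply/set_nbhsP; exists C; split.
have BVo : B `<=` V° by move=> z /BV.
have VoV : V° `<=` closure V := subset_trans (@interior_subset _ V) (@subset_closure _ V).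
have clZ : closed (closure V `&` ~` V°).
  by apply: closedI; [exact: closed_closure|apply: open_closedC; exact: open_interior].
(* [closure V] minus the interior of [V] misses [K], so by compactness some clopen [P] containing
   [x] misses it too. Hence [P] meets the interior and the closure of [V] in the same, clopen,
   set. *)
have [z [/VC Cz Vz]|P [[oP cP] Px] PZ] := compact_directed_closed
    (subclosed_compact clZ cX (@subsetT _ _)) GT GI (fun C GC => GC.1.2) _.
  apply: contrapT => nz; apply/Vz/BVo; rewrite BKC; split => // E GE.
  by apply: contrapT => nEz; apply: nz; exists E.
have PV : P `&` V° = P `&` closure V.
  apply/seteqP; split=> z [Pz Vz]; split => //.
    exact: VoV.
  by apply: contrapT => nVz; apply: (PZ z).
have clopPV : clopen (P `&` V°).
  split; first by apply: openI => //; exact: open_interior.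
  by rewrite PV; apply: closedI => //; exact: closed_closure.
(* If [x] is in [B], this clopen set contains [K]; otherwise its complement does, although [b] is in
   [K] and not in the complement. *)
have [Bx|nBx] := pselect (B x).
  apply/seteqP; split=> [z|z Kz]; first by rewrite BKC => -[].
  have [_ Vz] : (P `&` V°) z by apply: Kz; split=> //; split=> //; exact: BVo.
  by rewrite BKC; split => //; apply/VC/VoV.
exfalso; have Kb : K b by move: Bb; rewrite BKC => -[].
have : (~` (P `&` V°)) b.
  apply: Kb; split; first exact: clopenC.
  case=> _ Vx; apply: nBx; rewrite BKC; split=> //.
  exact/VC/VoV.
by apply; split; [exact: Kb|exact: BVo].
Qed.

Lemma stone_clopen_nbhs U x : open U -> U x ->
  exists V, [/\ clopen V, V x & V `<=` U].
Proof.
case: HX => cX hX _ oU Ux.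
have [|V [Vx cV] VU] := @zero_dimensional_cvg _ x hX stone_zero_dimensional cX U.
  exact: open_nbhs_nbhs.
by exists V.
Qed.

(** The compactness lemma is applied to complements of clopen subsets of [U], a family closed under
    intersection. *)
Lemma stone_clopen_between Z U : closed Z -> open U -> Z `<=` U ->
  exists V, [/\ clopen V, Z `<=` V & V `<=` U].
Proof.
move=> cZ oU ZU; case: HX => cX _ _.
have [||||C [cC CU] CZ] := @compact_directed_closed Z
    [set C | clopen C /\ ~` C `<=` U] (subclosed_compact cZ cX (@subsetT _ _)).
- by split; [exact: clopenT|rewrite setCT].
- move=> C D [cC CU] [cD DU]; split; first exact: clopenI.
  by rewrite setCI subUset.
- by move=> C [[]].
- move=> z /ZU /(stone_clopen_nbhs oU)[V [cV Vz VU]].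
  by exists (~` V); [split; [exact: clopenC|rewrite setCK]|apply].
by exists (~` C); split => //; [exact: clopenC|move=> z Zz /CZ].
Qed.

End StoneSpace.

(** * Real functions in C(X) *)

Section RealFunctions.
Variables (R : realType) (X : topologicalType).
Implicit Types (f g h u : X -> R) (F : X -> R[i]).

(** The self-adjoint part of C(X) is the image of the real continuous functions, so order questions
    are moved to real functions through this embedding. *)
Definition cfun f : X -> R[i] := fun x => (f x)%:C.

Lemma continuous_fadd f g : continuous f -> continuous g ->
  continuous (fun x => f x + g x).
Proof. by move=> cf cg x; apply: continuousD; [exact: cf|exact: cg]. Qed.

Lemma continuous_fsub f g : continuous f -> continuous g ->
  continuous (fun x => f x - g x).
Proof. by move=> cf cg x; apply: continuousB; [exact: cf|exact: cg]. Qed.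

Lemma continuous_fmul f g : continuous f -> continuous g ->
  continuous (fun x => f x * g x).
Proof. by move=> cf cg x; apply: continuousM; [exact: cf|exact: cg]. Qed.

Lemma continuous_fcst (t : R) : continuous (fun _ : X => t).
Proof. by move=> x; exact: cvg_cst. Qed.

Lemma continuous_fsum (q : nat -> X -> R) (l : seq nat) :
  (forall n, continuous (q n)) -> continuous (fun x => \sum_(i <- l) q i x).
Proof.
move=> cq; elim: l => [|i l ih].
  by under eq_fun do rewrite big_nil; exact: continuous_fcst.
by under eq_fun do rewrite big_cons; exact: continuous_fadd.
Qed.

Lemma continuous_indic (D : set X) : clopen D ->
  continuous (fun x => (x \in D)%:R : R).
Proof.
move=> [oD cD] x; apply: cvg_near_cst.
have [Dx|nDx] := pselect (D x).
  have : nbhs x D by exact: open_nbhs_nbhs.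
  by apply: filterS => y Dy; rewrite !mem_set.
have : nbhs x (~` D)%classic.
  by apply: open_nbhs_nbhs; split => //; exact: closed_openC.
by apply: filterS => y nDy; rewrite !memNset.
Qed.

Lemma cfunD f g : fadd (cfun f) (cfun g) = cfun (fun x => f x + g x).
Proof. by apply/funext => x; rewrite /fadd /cfun rmorphD. Qed.

Lemma cfunN f : fopp (cfun f) = cfun (fun x => - f x).
Proof. by apply/funext => x; rewrite /fopp /cfun rmorphN. Qed.

Lemma cfunM f g : fmul (cfun f) (cfun g) = cfun (fun x => f x * g x).
Proof. by apply/funext => x; rewrite /fmul /cfun rmorphM. Qed.

Lemma cfunZ (t : R) f : fscale t%:C (cfun f) = cfun (fun x => t * f x).
Proof. by apply/funext => x; rewrite /fscale /cfun rmorphM. Qed.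

Lemma cfunB f g : fadd (cfun f) (fopp (cfun g)) = cfun (fun x => f x - g x).
Proof. by rewrite cfunN cfunD. Qed.

Lemma cfun_inj f g : cfun f = cfun g -> f = g.
Proof. by move=> fg; apply/funext => x; have [] := congr1 (@^~ x) fg. Qed.

Lemma cont_cfun f : cont_fun (cfun f) <-> continuous f.
Proof.
by split=> [[]//|cf]; split => //=; exact: continuous_fcst.
Qed.

Lemma selfadj_cfun f : selfadj (@fstar R X) (cfun f).
Proof. by apply/funext => x; rewrite /fstar /cconj conjc_real. Qed.

Lemma selfadj_cont F : cont_fun F -> selfadj (@fstar R X) F ->
  exists2 f, continuous f & F = cfun f.
Proof.
move=> [cF _] sF; exists (fun x => complex.Re (F x)) => //.
apply/funext => x; have := congr1 (@^~ x) sF; rewrite /fstar /cconj /cfun.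
case: (F x) => a b /= [ba]; apply/eqP; rewrite eq_complex /= eqxx /=.
by apply/eqP; lra.
Qed.

Lemma CX_positive_cfun f : CX_positive (cfun f) <-> continuous f /\ forall x, 0 <= f x.
Proof.
split=> [[G [[cG1 cG2] fG]]|[cf f0]]; last first.
  exists (cfun (fun x => Num.sqrt (f x))); split.
    by apply/cont_cfun => x; apply: continuous_comp; [exact: cf|exact: sqrt_continuous].
  rewrite (selfadj_cfun _) cfunM; apply/funext => x.
  by rewrite /cfun -expr2 sqr_sqrtr.
have -> : f = fun x => complex.Re (G x) * complex.Re (G x) + complex.Im (G x) * complex.Im (G x).
  apply/funext => x; have := congr1 (fun F => complex.Re (F x)) fG.
  by rewrite /fmul /fstar /cconj /cfun /=; case: (G x) => a b /= ->; rewrite mulNr opprK.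
split; first by apply: continuous_fadd; exact: continuous_fmul.
by move=> x; rewrite -!expr2 addr_ge0 ?sqr_ge0.
Qed.

Lemma CX_le_cfun f g : continuous f -> continuous g ->
  CX_le (cfun f) (cfun g) <-> forall x, f x <= g x.
Proof.
move=> cf cg; rewrite /CX_le /sa_le cfunB.
rewrite -[positive _ _ _ _]/(CX_positive _) CX_positive_cfun.
split=> [[_ fg] x|fg]; first by rewrite -subr_ge0.
by split=> [|x]; [exact: continuous_fsub|rewrite subr_ge0].
Qed.

(** Only continuous upper bounds compete, so [u] may exceed the pointwise supremum. *)
Definition fun_sup I (f : I -> X -> R) u := [/\ continuous u,
  (forall i x, f i x <= u x) &
  (forall c, continuous c -> (forall i x, f i x <= c x) -> forall x, u x <= c x)].

Lemma CX_is_sup_cfun I (f : I -> X -> R) u : (forall i, continuous (f i)) ->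
  CX_is_sup (fun i => cfun (f i)) (cfun u) <-> fun_sup f u.
Proof.
move=> cf; split=> [[/cont_cfun cu _ fu lub]|[cu fu lub]].
  split => // [i|c cc fc]; first by apply/CX_le_cfun => //; exact: fu.
  apply/CX_le_cfun => //; apply: lub; [exact/cont_cfun|exact: selfadj_cfun|].
  by move=> i; apply/CX_le_cfun.
split; [exact/cont_cfun|exact: selfadj_cfun| |].
  by move=> i; apply/CX_le_cfun => //; exact: fu.
move=> C cC /(selfadj_cont cC)[c cc ->] fc; apply/CX_le_cfun => //.
by apply: lub => // i; apply/CX_le_cfun => //; exact: fc.
Qed.

Lemma fin_sum_cfun (q : nat -> X -> R) l :
  fin_sum (@fadd R X) (@fzero R X) (fun n => cfun (q n)) l =
  cfun (fun x => \sum_(i <- l) q i x).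
Proof.
elim: l => [|i l ih] /=; first by apply/funext => x; rewrite /cfun big_nil.
by rewrite ih cfunD; congr cfun; apply/funext => x; rewrite big_cons.
Qed.

Lemma CX_is_inf_sum_cfun (q : nat -> X -> R) u : (forall n, continuous (q n)) ->
  CX_is_inf_sum (fun n => cfun (q n)) (cfun u) <->
  fun_sup (fun (l : {l : seq nat | uniq l}) x => \sum_(i <- proj1_sig l) q i x) u.
Proof.
move=> cq; rewrite -CX_is_sup_cfun; last by move=> l; exact: continuous_fsum.
rewrite /CX_is_inf_sum /is_inf_sum /CX_is_sup.
suff -> : (fun l : {l : seq nat | uniq l} => fin_sum (@fadd R X) (@fzero R X)
    (fun n => cfun (q n)) (proj1_sig l)) =
  (fun l => cfun (fun x => \sum_(i <- proj1_sig l) q i x)) by [].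
by apply/funext => l; rewrite fin_sum_cfun.
Qed.

Lemma CX_projection_cfun F : CX_projection F ->
  exists q, [/\ continuous q, F = cfun q & forall x, q x * q x = q x].
Proof.
move=> [cF [FF sF]]; have [q cq FE] := selfadj_cont cF sF.
exists q; split => //; move: FF; rewrite FE cfunM => /cfun_inj qq x.
by rewrite -[in RHS]qq.
Qed.

(* At each point at most one of the orthogonal idempotents is nonzero. *)
Lemma sum_orthogonal_idem (q : nat -> X -> R) l x : uniq l ->
  (forall n x, q n x * q n x = q n x) ->
  (forall n m, n <> m -> forall x, q n x * q m x = 0) ->
  \sum_(i <- l) q i x = (has (fun i => q i x != 0) l)%:R.
Proof.
move=> ul qq qo; elim: l ul => [|i l ih] /=; first by rewrite big_nil.
move=> /andP[il ul]; rewrite big_cons; have [qi0|qi0] := eqVneq (q i x) 0.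
  by rewrite qi0 add0r ih.
have -> : q i x = 1.
  by apply: (mulfI qi0); rewrite mulr1.
rewrite big_seq big1 ?addr0// => j jl.
have ij : i <> j by move=> ij; rewrite ij jl in il.
by have /eqP := qo i j ij x; rewrite mulf_eq0 (negPf qi0) /= => /eqP.
Qed.

End RealFunctions.

(** * Positive maps on C(X); normality implies additivity *)

Section PositiveMap.
Variables (R : realType) (A : algType R[i]) (star : A -> A) (nrm : A -> R).
Hypothesis HA : cstar_axioms star nrm.
Variables (X : topologicalType) (phi : (X -> R[i]) -> A).
Hypothesis Hphi : positive_map star phi.
Implicit Types (f g u : X -> R).

Local Notation spos := (spos star nrm).

Lemma phiD f g : continuous f -> continuous g ->
  phi (cfun (fun x => f x + g x)) = phi (cfun f) + phi (cfun g).
Proof.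
by move=> /cont_cfun cf /cont_cfun cg; rewrite -cfunD; case: Hphi => + _ _; apply.
Qed.

Lemma phiZ (t : R) f : continuous f ->
  phi (cfun (fun x => t * f x)) = t%:C *: phi (cfun f).
Proof. by move=> /cont_cfun cf; rewrite -cfunZ; case: Hphi => _ + _; apply. Qed.

Lemma phiB f g : continuous f -> continuous g ->
  phi (cfun (fun x => f x - g x)) = phi (cfun f) - phi (cfun g).
Proof.
move=> cf cg; apply/eqP; rewrite eq_sym subr_eq -phiD//; last exact: continuous_fsub.
by apply/eqP; congr (phi (cfun _)); apply/funext => x; rewrite subrK.
Qed.

Lemma phi_spos f : continuous f -> (forall x, 0 <= f x) -> spos (phi (cfun f)).
Proof.
move=> cf f0; apply/(A_positiveP HA); case: Hphi => _ _; apply.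
  exact/cont_cfun.
exact/CX_positive_cfun.
Qed.

Lemma phi_sum (q : nat -> X -> R) l : (forall n, continuous (q n)) ->
  phi (cfun (fun x => \sum_(i <- l) q i x)) =
  fin_sum (fun a b : A => a + b) 0 (fun n => phi (cfun (q n))) l.
Proof.
move=> cq; elim: l => [|i l ih].
  have := @phiZ 0 (fun=> 0) (@continuous_fcst R X 0); rewrite scale0r => <-.
  by congr (phi (cfun _)); apply/funext => x; rewrite big_nil mul0r.
transitivity (phi (cfun (q i)) + phi (cfun (fun x => \sum_(j <- l) q j x))).
  rewrite -phiD//; last exact: continuous_fsum.
  by congr (phi (cfun _)); apply/funext => x; rewrite big_cons.
by rewrite ih.
Qed.

(* [4 f = (f + 1)^2 - (f - 1)^2] is a difference of positive functions. *)
Lemma phi_star f : continuous f -> star (phi (cfun f)) = phi (cfun f).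
Proof.
move=> cf; have c1 := @continuous_fcst R X 1.
have sq_star g : continuous g -> star (phi (cfun (fun x => g x * g x))) =
    phi (cfun (fun x => g x * g x)).
  move=> cg; have [|x|//] := @phi_spos (fun x => g x * g x).
    exact: continuous_fmul.
  by rewrite -expr2 sqr_ge0.
have cfD := continuous_fadd cf c1; have cfB := continuous_fsub cf c1.
have cq := continuous_fsub (continuous_fmul cfD cfD) (continuous_fmul cfB cfB).
have -> : f = fun x => 4^-1 * ((f x + 1) * (f x + 1) - (f x - 1) * (f x - 1)).
  by apply/funext => x; field.
rewrite phiZ// phiB ?(starZr HA) ?(starB HA) ?sq_star//; exact: continuous_fmul.
Qed.

Lemma A_is_supP I (F : I -> A) s : A_is_sup star F s <->
  [/\ star s = s, forall i, spos (s - F i) &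
    forall c, star c = c -> (forall i, spos (c - F i)) -> spos (c - s)].
Proof.
split=> [[_ ss Fs lub]|[ss Fs lub]]; split => //.
- by move=> i; apply/(A_positiveP HA)/Fs.
- move=> c sc Fc; apply/(A_positiveP HA); apply: lub => // i.
  by apply/(A_positiveP HA)/Fc.
- by move=> i; apply/(A_positiveP HA)/Fs.
- move=> c _ sc Fc; apply/(A_positiveP HA); apply: lub => // i.
  by apply/(A_positiveP HA)/Fc.
Qed.

Lemma sigma_normal_additive : sigma_normal star phi -> sigma_additive_proj star phi.
Proof.
move=> normal p s pp po ps.
have [q qP] := choice (fun n => CX_projection_cfun (pp n)).
have cq n : continuous (q n) by case: (qP n).
have qq n x : q n x * q n x = q n x by case: (qP n).
have pE : p = fun n => cfun (q n) by apply/funext => n; case: (qP n).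
have qo n m : n <> m -> forall x, q n x * q m x = 0.
  move=> nm x; have := congr1 (fun F => complex.Re (F x)) (po n m nm).
  by rewrite pE cfunM.
rewrite {}pE in ps *.
have [u cu su] : exists2 u, continuous u & s = cfun u.
  by case: ps => cs ss _ _; exact: selfadj_cont.
rewrite {}su in ps *; have [_ qu lub] := (CX_is_inf_sum_cfun _ cq).1 ps.
have q0 n x : 0 <= q n x by rewrite -qq -expr2 sqr_ge0.
pose a n x := \sum_(i <- iota 0 n) q i x.
have ca n : continuous (a n) by exact: continuous_fsum.
(* The successors make the initial segment include the largest index of [l]; the segment is [l]
   together with further indices, whose terms are nonnegative. *)
have sum_le_a (l : seq nat) : uniq l -> forall x,
    \sum_(i <- l) q i x <= a (\max_(i <- l) i.+1) x.
  move=> ul x; rewrite /a [leRHS](perm_big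
      (l ++ [seq i <- iota 0 (\max_(i <- l) i.+1) | i \notin l])).
    by rewrite big_cat /= lerDl sumr_ge0.
  apply: uniq_perm; first exact: iota_uniq.
    rewrite cat_uniq ul filter_uniq ?iota_uniq// andbT.
    by apply/hasPn => i; rewrite mem_filter => /andP[].
  move=> i; rewrite mem_cat mem_filter mem_iota add0n /=.
  have [il|//] := boolP (i \in l); rewrite /= -ltnS ltnS.
  by rewrite (bigD1_seq i)//= leq_max leqnn.
have sup_a : CX_is_sup (fun n => cfun (a n)) (cfun u).
  apply/CX_is_sup_cfun => //; split => //.
    by move=> n x; exact: (qu (exist _ (iota 0 n) (iota_uniq 0 n))).
  move=> c cc ac; apply: lub => // -[l ul] x /=.
  exact: le_trans (sum_le_a l ul x) (ac _ x).
have mono_a : CX_monotone (fun n => cfun (a n)).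
  split=> n; first by split; [exact/cont_cfun|exact: selfadj_cfun].
  apply/CX_le_cfun => // x; rewrite /a -addn1 iotaD big_cat /= lerDl.
  by rewrite big_seq1.
have bnd_a : CX_bounded (fun n => cfun (a n)).
  exists 1 => n x; rewrite cabs_real /a sum_orthogonal_idem ?iota_uniq//.
  by case: has; rewrite ?normr1 ?normr0.
have /A_is_supP[su au lubA] := normal _ _ mono_a bnd_a sup_a.
apply/A_is_supP; split => //.
  move=> [l ul] /=; rewrite -phi_sum// -phiB//; last exact: continuous_fsum.
  apply: phi_spos; first by apply: continuous_fsub => //; exact: continuous_fsum.
  by move=> x; rewrite subr_ge0; exact: (qu (exist _ l ul)).
(* Initial segments are themselves finite index lists, so a bound for all finite sums bounds the
   sequence. *)
move=> c sc qc; apply: lubA => // n; rewrite /a phi_sum//.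
exact: (qc (exist _ (iota 0 n) (iota_uniq 0 n))).
Qed.

End PositiveMap.

(** * Additivity implies normality on a Stone space *)

Section Converse.
Variables (R : realType) (X : topologicalType).
Hypothesis HX : stone_space X.
Local Open Scope classical_set_scope.

Lemma closed_le_fun (f : X -> R) (t : R) : continuous f -> closed [set x | f x <= t].
Proof.
move=> cf; apply: (@preimage_closed _ _ f [set y | y <= t]); last exact: closed_le.
by move=> x _; exact: cf.
Qed.

Lemma open_lt_fun (f : X -> R) (t : R) : continuous f -> open [set x | f x < t].
Proof.
move=> cf; apply: (@open_comp _ _ f [set y | y < t]); last exact: open_lt.
by move=> x _; exact: cf.
Qed.

Lemma clopen_seqDU (W : nat -> set X) n : (forall i, clopen (W i)) -> clopen (seqDU W n).
Proof.
move=> cW; rewrite /seqDU setDE; apply: clopenI => //; apply: (clopenC set0).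
by apply: big_ind => //; [exact: clopen0|exact: clopenU].
Qed.

Lemma seqDU_ex (W : nat -> set X) n x : W n x -> exists m, seqDU W m x.
Proof.
move=> Wx; have : (\bigcup_n W n) x by exists n.
by rewrite seqDU_bigcup_eq => -[m _ Dx]; exists m.
Qed.

Lemma idem_indic (D : set X) x : (x \in D)%:R * (x \in D)%:R = (x \in D)%:R :> R.
Proof. by case: (x \in D); rewrite ?mulr1 ?mulr0. Qed.

Lemma orthogonal_indic_seqDU (W : nat -> set X) n m x : n <> m ->
  (x \in seqDU W n)%:R * (x \in seqDU W m)%:R = 0 :> R.
Proof.
move=> nm; have [/set_mem xn|_] := boolP (x \in seqDU W n); last by rewrite mul0r.
have [/set_mem xm|_] := boolP (x \in seqDU W m); last by rewrite mulr0.
by case: nm; apply: (trivIset_seqDU W) => //; exists x.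
Qed.

(* If [u] is the supremum of [g], then the sets [W n] cover a dense subset:
   a clopen [K] missing all of them would make [u - e 1_K] a smaller upper bound. *)
Lemma fun_sup_indic (g : nat -> X -> R) u (e : R) (W : nat -> set X) :
  (forall n, continuous (g n)) -> fun_sup g u -> 0 < e ->
  (forall n, clopen (W n)) -> (forall n, [set x | u x - g n x <= e] `<=` W n) ->
  fun_sup (fun (l : {l : seq nat | uniq l}) x =>
    \sum_(i <- proj1_sig l) (x \in seqDU W i)%:R) (fun=> 1 : R).
Proof.
move=> cg [cu gu lub] e0 cW gW; split; first exact: continuous_fcst.
  move=> [l ul] x /=; rewrite (@sum_orthogonal_idem _ _ (fun i x => (x \in seqDU W i)%:R))//.
  - by rewrite lern1 leq_b1.
  - by move=> n y; exact: idem_indic.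
  - by move=> n m nm y; exact: orthogonal_indic_seqDU.
move=> c cc Wc x; rewrite leNgt; apply/negP => cx1.
have [K [cK Kx Kc]] := stone_clopen_nbhs HX (open_lt_fun 1 cc) cx1.
(* A point of [W n] lies in some disjointified set, where a one-term sum already forces [c >= 1];
   but [c < 1] on [K]. *)
have KW n y : K y -> ~ W n y.
  move=> Ky /seqDU_ex[m Dy]; have := Wc (exist _ [:: m] isT) y.
  by rewrite /= big_seq1 mem_set// leNgt Kc.
have [] : ~ u x <= u x - e * (x \in K)%:R.
  by rewrite mem_set// mulr1; lra.
apply: (lub (fun x => u x - e * (x \in K)%:R)) => [|n y].
  apply: continuous_fsub => //; apply: continuous_fmul; first exact: continuous_fcst.
  exact: continuous_indic.
have [/set_mem Ky|_] := boolP (y \in K); last by rewrite mulr0 subr0.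
rewrite mulr1 leNgt; apply/negP => h; apply: (KW n y Ky); apply: gW => /=; lra.
Qed.

Variables (A : algType R[i]) (star : A -> A) (nrm : A -> R).
Hypothesis HA : cstar_axioms star nrm.
Variable phi : (X -> R[i]) -> A.
Hypothesis Hphi : positive_map star phi.

Lemma sigma_additive_normal : sigma_additive_proj star phi -> sigma_normal star phi.
Proof.
move=> additive a s [ma mono] [M aM] sup_s.
have a_real n : exists f : X -> R, continuous f /\ a n = cfun f.
  by have [ca sa] := ma n; have [f] := selfadj_cont ca sa; exists f.
have [g gP] := choice a_real.
have cg n : continuous (g n) by case: (gP n).
have aE : a = fun n => cfun (g n) by apply/funext => n; case: (gP n).
rewrite {}aE in mono aM sup_s * => {ma gP}.
have [u cu su] : exists2 u, continuous u & s = cfun u.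
  by case: sup_s => cs ss _ _; exact: selfadj_cont.
rewrite {}su in sup_s *; have supu := (CX_is_sup_cfun _ cg).1 sup_s.
have [_ gu lub] := supu.
have gM n x : `|g n x| <= M by rewrite -cabs_real; exact: aM.
have uM x : u x <= M.
  by apply: (lub (fun=> M)); [exact: continuous_fcst|move=> n y; exact: ler_normlW].
have g_mono m n x : (m <= n)%N -> g m x <= g n x.
  move: m n; apply: (homo_leq lexx le_trans) => n.
  by have /CX_le_cfun := mono n; apply.
(* Both [u] and [- g n] are at most [|M|]; the added 1 makes [N] invertible. *)
pose N := 2 * `|M| + 1; have N0 : 0 < N by rewrite /N; have := normr_ge0 M; lra.
have fN n x : u x - g n x <= N.
  have := gM n x; rewrite ler_norml => /andP[gN _].
  by have := uM x; have := ler_norm M; rewrite /N; lra.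
have c1 := @continuous_fcst R X 1.
apply/(A_is_supP HA); split => [|n|c sc gc].
- exact: (phi_star HA Hphi).
- rewrite -(phiB Hphi)//; apply: (phi_spos HA Hphi); first exact: continuous_fsub.
  by move=> x; rewrite subr_ge0.
apply: (@spos_archimedean _ _ _ _ HA _ (phi (cfun (fun=> 1)))).
  by rewrite (starB HA) sc (phi_star HA Hphi).
move=> e e0.
have separate n : exists V : set X, [/\ clopen V,
    [set x | u x - g n x <= e / 2] `<=` V & V `<=` [set x | u x - g n x < e]].
  have cf := continuous_fsub cu (cg n).
  apply: (stone_clopen_between HX); [exact: closed_le_fun|exact: open_lt_fun|].
  by move=> x /=; lra.
have [W WP] := choice separate.
pose q n x : R := (x \in seqDU W n)%:R.
have cq n : continuous (q n).
  by apply/continuous_indic/clopen_seqDU => i; case: (WP i).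
have qq n x : q n x * q n x = q n x by exact: idem_indic.
have qo n m : n <> m -> forall x, q n x * q m x = 0.
  by move=> nm x; exact: orthogonal_indic_seqDU.
have /additive : CX_is_inf_sum (fun n => cfun (q n)) (cfun (fun=> 1)).
  apply/CX_is_inf_sum_cfun => //; apply: (fun_sup_indic (e := e / 2) cg supu).
  - by lra.
  - by move=> n; case: (WP n).
  - by move=> n; case: (WP n).
case/(_ _ _)/(A_is_supP HA) => [n|n m nm|_ _ lub1].
- split; first exact/cont_cfun.
  split; last exact: selfadj_cfun.
  by rewrite cfunM; congr cfun; apply/funext => x.
- by rewrite cfunM; apply/funext => x; rewrite /cfun qo.
set P := phi (cfun (fun=> 1)) in lub1 *; set U := phi (cfun u) in gc *.
have sP : star P = P by exact: (phi_star HA Hphi).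
have sU : star U = U by exact: (phi_star HA Hphi).
(* Chosen so that [P <= d] is, after scaling by [N], exactly [0 <= c - U + e P]. *)
pose d := P + N^-1%:C *: (c - U + e%:C *: P).
have NN (b : A) : b = N^-1%:C *: (N%:C *: b).
  by rewrite scalerA -rmorphM mulVf ?gt_eqF// scale1r.
have : spos star nrm (d - P).
  apply: lub1; first by rewrite (starD HA) (starZr HA) (starD HA) (starB HA) (starZr HA) sP sU sc.
  move=> [l ul] /=; rewrite -(phi_sum Hphi)//.
  set S := phi _; set n := \max_(i <- l) i.
  (* The slack in [u - g n <= N (1 - S) + e]. It yields [N (d - S) = (c - phi (g n)) + phi h], a sum
     of two positive elements. *)
  pose h x := (N * (1 - \sum_(i <- l) q i x) + e * 1) - (u x - g n x).
  have cS : continuous (fun x => \sum_(i <- l) q i x) by exact: continuous_fsum.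
  have c1S := continuous_fsub c1 cS.
  have cNS := continuous_fmul (@continuous_fcst R X N) c1S.
  have ce := continuous_fmul (@continuous_fcst R X e) c1.
  have cNe := continuous_fadd cNS ce; have cf := continuous_fsub cu (cg n).
  have ch : continuous h by exact: continuous_fsub.
  have hE : phi (cfun h) = (N%:C *: (P - S) + e%:C *: P) - (U - phi (cfun (g n))).
    by rewrite (phiB Hphi)// (phiB Hphi cu)// (phiD Hphi)// !(phiZ Hphi)// (phiB Hphi).
  have -> : d - S = N^-1%:C *: ((c - phi (cfun (g n))) + phi (cfun h)).
    rewrite hE opprB addrCA subrKA addrC addrA -addrA.
    rewrite /d addrAC {1}[P - S]NN -scalerDr; congr (_ *: _).
    by rewrite addrCA.
  apply: (spos_scale HA); first by rewrite invr_gt0.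
  apply: (spos_add HA) => //; apply: (phi_spos HA Hphi) => // x.
  (* Where the sum is 1, the point lies in some [W i] with [i <= n], so [u - g n <= u - g i < e]
     there; where it is 0, the bound [N] suffices. *)
  rewrite /h mulr1 sum_orthogonal_idem//; case: hasP => [[i il qi0]|_] /=.
    have Wix : W i x.
      apply: (@subset_seqDU _ W i); apply: contrapT => nx.
      by move: qi0; rewrite /q memNset// eqxx.
    have [_ _ /(_ x Wix) /= fi] := WP i.
    have : g i x <= g n x by apply: g_mono; rewrite /n (big_rem i)//= leq_maxl.
    by rewrite subrr mulr0; lra.
  by have := fN n x; rewrite subr0 mulr1; lra.
rewrite /d addrC addKr => /(spos_scale HA N0).
by rewrite scalerA -rmorphM mulfV ?gt_eqF// scale1r.
Qed.

End Converse.

Theorem theorem4p5 (R : realType) (A : algType R[i]) (star : A -> A) (nrm : A -> R)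
  (HA : cstar_axioms star nrm) (X : topologicalType) (HX : stone_space X)
  (phi : (X -> R[i]) -> A) (Hphi : positive_map star phi) :
  sigma_normal star phi <-> sigma_additive_proj star phi.
Proof.
split; first exact: (sigma_normal_additive HA Hphi).
exact: (sigma_additive_normal HX HA Hphi).
Qed.
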